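(* Let $n\geq 1$, let $q\in\mathbb{C}$ be a fixed non-zero element, let $t_k=\mathrm{Tr}({}_qX^k)\in\mathcal{O}(M_q)$ be the trace of the $k$-th quantum power of the generic $n\times n$ quantum matrix $X=(x_{ij})$, and let $\sigma_k\in\mathcal{O}(M_q)$ be the sum of the principal $k\times k$ quantum minors for $1\leq k\leq n$, with $\sigma_k=0$ for $k>n$. Then for every $k=1,2,\dots$ we have $$t_k-t_{k-1}\sigma_1+t_{k-2}\sigma_2+\dots+(-1)^{k-1}t_1\sigma_{k-1}+(-1)^kk\sigma_k=0,$$ that is, $\;t_k+\sum_{j=1}^{k-1}(-1)^j t_{k-j}\sigma_j+(-1)^k k\,\sigma_k=0$ in $\mathcal{O}(M_q)$.
   Context: For integers $i,j$ put $\theta(i,j)=1$ if $i<j$, $\theta(i,j)=0$ if $i=j$, and $\theta(i,j)=-1$ if $i>j$. The coordinate ring $\mathcal{O}(M_q)$ of $n\times n$ quantum matrices is the (unital, associative) $\mathbb{C}$-algebra generated by $x_{ij}$, $1\leq i,j\leq n$, subject to the relations $$x_{ij}x_{kl}-x_{kl}x_{ij}=(q^{\theta(j,l)}-q^{-\theta(i,k)})x_{il}x_{kj},\qquad 1\leq i,j,k,l\leq n,$$ where $q$ is a fixed non-zero element of $\mathbb{C}$. Let $X$ be the $n\times n$ matrix with $(i,j)$ entry $x_{ij}$. For $n\times n$ matrices $A=(a_{ij})$, $B=(b_{ij})$ with entries from $\mathcal{O}(M_q)$, the $q$-multiplication $A\star B$ is the $n\times n$ matrix with $(i,j)$ entry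 $$(A\star B)_{ij}=\sum_{k=1}^n q^{\theta(j,k)}a_{ik}b_{kj}.$$ (This multiplication is not associative.) The quantum powers of $X$ are defined recursively by ${}_qX^0=I$ (the identity matrix), ${}_qX^1=X$, and ${}_qX^k=X\star({}_qX^{k-1})$ for $k\geq 2$. $\mathrm{Tr}$ denotes the usual trace (the sum of the diagonal entries) of a matrix. Quantum minors: for $k$-element subsets $K=\{i_1<\dots<i_k\}$ and $L=\{j_1<\dots<j_k\}$ of $\{1,\dots,n\}$, the $k\times k$ quantum minor is $$[K|L]=\sum_{\pi\in S_k}(-q)^{l(\pi)}x_{i_1,j_{\pi(1)}}\cdots x_{i_k,j_{\pi(k)}},$$ where $l(\pi)$ is the number of pairs $a<b$ with $\pi(a)>\pi(b)$. For $k=1,\dots,n$, $\sigma_k=\sum_{K}[K|K]$, the sum over all $k$-element subsets $K$ of $\{1,\dots,n\}$; and $\sigma_{n+1}=\sigma_{n+2}=\dots=0$. *)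

(* Defs.v *)
From HB Require Import structures.
From mathcomp Require Import all_boot all_order all_algebra all_fingroup.
From mathcomp Require Import generic_quotient ring_quotient complex.
From mathcomp Require Import boolp reals.
From mathcomp Require Import finmap monalg.

Set Implicit Arguments.
Unset Strict Implicit.
Unset Printing Implicit Defensive.

Import GRing.Theory.

Local Open Scope ring_scope.
Local Open Scope quotient_scope.

Definition theta (i j : nat) : int :=
  if (i < j)%N then 1 else if i == j then 0 else -1.

Lemma malg_scalerAr (M : monomType) (K : fieldType) (c : K)
    (u v : {malg K[M]}) : c *: (u * v) = u * (c *: v).
Proof.
have [->|c0] := eqVneq c 0; first by rewrite !scale0r mulr0.
rewrite (malgME u (c *: v)) (malgME u v) scaler_sumr.
apply: eq_bigr => k1 _; rewrite scaler_sumr msuppZ (negbTE c0).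
apply: eq_bigr => k2 _; apply/malgP => k.
by rewrite !mcoeffZ !mcoeffU !mulrnAr mulrCA.
Qed.

Lemma mcoeff1M (M : monomType) (K : fieldType) (u v : {malg K[M]}) :
  mcoeff mone (u * v) = mcoeff mone u * mcoeff mone v.
Proof. exact: rmorphM. Qed.

Lemma mcoeff1_comb (M : monomType) (K : fieldType) (c : K)
    (u1 u2 u3 u4 u5 u6 : {malg K[M]}) :
    mcoeff mone u1 = 0 -> mcoeff mone u3 = 0 -> mcoeff mone u5 = 0 ->
  mcoeff mone (u1 * u2 - u3 * u4 - c *: (u5 * u6)) = 0.
Proof.
move=> h1 h3 h5; rewrite !mcoeffB mcoeffZ !mcoeff1M h1 h3 h5.
by rewrite !mul0r mulr0 !subr0.
Qed.

(* The free unital associative K-algebra on generators indexed by the pairs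
   (i, j), as the monoid algebra of the free monoid on these pairs. *)
Definition word (n : nat) : monomType := {fmonom ('I_n * 'I_n)%type}.

Notation freeAlg K n := {malg K[word n]}.

Section QuantumMatrixAlgebra.
Variables (K : fieldType) (q : K) (n : nat).

Implicit Types u v w : freeAlg K n.

Definition fgen (i j : 'I_n) : freeAlg K n := << (fmu (i, j) : word n) >>.

Definition qrel (i j k l : 'I_n) : freeAlg K n :=
  fgen i j * fgen k l - fgen k l * fgen i j
  - (q ^ theta j l - q ^ (- theta i k)) *: (fgen i l * fgen k j).

(* the two-sided ideal generated by the elements qrel i j k l *)
Inductive in_qideal : freeAlg K n -> Prop :=
| qideal_rel i j k l : in_qideal (qrel i j k l)
| qideal_zero : in_qideal 0
| qideal_sub u v : in_qideal u -> in_qideal v -> in_qideal (u - v)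
| qideal_mull w u : in_qideal u -> in_qideal (w * u)
| qideal_mulr u w : in_qideal u -> in_qideal (u * w).

Definition qideal : {pred freeAlg K n} := fun u => `[< in_qideal u >].

Lemma qidealP u : reflect (in_qideal u) (u \in qideal).
Proof. exact: asboolP. Qed.

Lemma qideal_zmod_closed : zmod_closed qideal.
Proof.
split; first by apply/qidealP; exact: qideal_zero.
by move=> u v /qidealP hu /qidealP hv; apply/qidealP; exact: qideal_sub.
Qed.

HB.instance Definition _ :=
  GRing.isZmodClosed.Build (freeAlg K n) qideal qideal_zmod_closed.

Lemma qidealMl w u : u \in qideal -> w * u \in qideal.
Proof. by move=> /qidealP hu; apply/qidealP; exact: qideal_mull. Qed.

Lemma qidealMr w u : u \in qideal -> u * w \in qideal.
Proof. by move=> /qidealP hu; apply/qidealP; exact: qideal_mulr. Qed.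

Lemma qidealZ c u : u \in qideal -> c *: u \in qideal.
Proof. by rewrite -mul_malgC; exact: qidealMl. Qed.

(* The constant coefficient kills the ideal, so the quotient is nonzero. *)
Lemma mcoeff1_fgen i j : mcoeff mone (fgen i j) = 0.
Proof. by rewrite mcoeffU1 fm1_eq1. Qed.

Lemma mcoeff1_qideal u : u \in qideal -> mcoeff mone u = 0.
Proof.
move=> /qidealP; elim=> {u} [i j k l||u v _ hu _ hv|w u _ hu|u w _ hu].
- by apply: mcoeff1_comb; exact: mcoeff1_fgen.
- exact: mcoeff0.
- by rewrite mcoeffB hu hv subr0.
- by rewrite mcoeff1M hu mulr0.
- by rewrite mcoeff1M hu mul0r.
Qed.

Lemma qideal_neq1 : 1 \notin qideal.
Proof.
apply/negP => /mcoeff1_qideal /eqP.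
by rewrite mcoeff1 eqxx oner_eq0.
Qed.

(* O(M_q): the quotient of the free algebra by this ideal.  The algebra
   structure is provided here because ring_quotient only treats ideals of
   commutative rings. *)
Definition OMq : Type := {ideal_quot qideal}.

HB.instance Definition _ := GRing.Zmodule.on OMq.
HB.instance Definition _ := EqQuotient.on OMq.

Definition OMq_pi (u : freeAlg K n) : OMq := \pi_OMq u.

Lemma OMq_piP u v : (u - v \in qideal) = (OMq_pi u == OMq_pi v).
Proof. exact: Quotient.idealrBE. Qed.

Lemma OMq_eq u v : u - v \in qideal -> OMq_pi u = OMq_pi v.
Proof. by rewrite OMq_piP => /eqP. Qed.

Lemma OMq_reprK (a : OMq) : OMq_pi (repr a) = a.
Proof. exact: reprK. Qed.

Lemma OMq_repr u : repr (OMq_pi u) - u \in qideal.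
Proof. by rewrite OMq_piP OMq_reprK. Qed.

Lemma OMq_piD u v : OMq_pi (u + v) = OMq_pi u + OMq_pi v.
Proof. exact: Quotient.pi_add. Qed.

Definition OMq_one : OMq := OMq_pi 1.
Definition OMq_mul (a b : OMq) : OMq := OMq_pi (repr a * repr b).
Definition OMq_scale (c : K) (a : OMq) : OMq := OMq_pi (c *: repr a).

Lemma OMq_piM u v : OMq_pi (u * v) = OMq_mul (OMq_pi u) (OMq_pi v).
Proof.
apply/esym/OMq_eq; set u' := repr _; set v' := repr _.
have -> : u' * v' - u * v = (u' - u) * v' + u * (v' - v).
  by rewrite mulrBl mulrBr addrA subrK.
by apply: rpredD; [apply/qidealMr/OMq_repr | apply/qidealMl/OMq_repr].
Qed.

Lemma OMq_piZ c u : OMq_pi (c *: u) = OMq_scale c (OMq_pi u).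
Proof.
by apply/esym/OMq_eq; rewrite -scalerBr; apply/qidealZ/OMq_repr.
Qed.

Lemma OMq_ind (P : OMq -> Prop) : (forall u, P (OMq_pi u)) -> forall a, P a.
Proof. by move=> hP a; rewrite -(OMq_reprK a). Qed.

Lemma OMq_mulA : associative OMq_mul.
Proof.
elim/OMq_ind=> u; elim/OMq_ind=> v; elim/OMq_ind=> w.
by rewrite -!OMq_piM mulrA.
Qed.

Lemma OMq_mul1 : left_id OMq_one OMq_mul.
Proof. by elim/OMq_ind=> u; rewrite -OMq_piM mul1r. Qed.

Lemma OMq_mulr1 : right_id OMq_one OMq_mul.
Proof. by elim/OMq_ind=> u; rewrite -OMq_piM mulr1. Qed.

Lemma OMq_mulDl : left_distributive OMq_mul +%R.
Proof.
elim/OMq_ind=> u; elim/OMq_ind=> v; elim/OMq_ind=> w.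
by rewrite -!(OMq_piD, OMq_piM) mulrDl.
Qed.

Lemma OMq_mulDr : right_distributive OMq_mul +%R.
Proof.
elim/OMq_ind=> u; elim/OMq_ind=> v; elim/OMq_ind=> w.
by rewrite -!(OMq_piD, OMq_piM) mulrDr.
Qed.

Lemma OMq_pi0 : OMq_pi 0 = 0.
Proof. by apply: (addrI (OMq_pi 0)); rewrite -OMq_piD !addr0. Qed.

Lemma OMq_one_neq0 : OMq_one != 0.
Proof. by rewrite -OMq_pi0 -OMq_piP subr0 qideal_neq1. Qed.

HB.instance Definition _ := GRing.Zmodule_isNzRing.Build OMq
  OMq_mulA OMq_mul1 OMq_mulr1 OMq_mulDl OMq_mulDr OMq_one_neq0.

Lemma OMq_scaleA (c d : K) (a : OMq) :
  OMq_scale c (OMq_scale d a) = OMq_scale (c * d) a.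
Proof. by elim/OMq_ind: a => u; rewrite -!OMq_piZ scalerA. Qed.

Lemma OMq_scale1 : left_id 1 OMq_scale.
Proof. by elim/OMq_ind=> u; rewrite -OMq_piZ scale1r. Qed.

Lemma OMq_scaleDr : right_distributive OMq_scale +%R.
Proof.
move=> c; elim/OMq_ind=> u; elim/OMq_ind=> v.
by rewrite -!(OMq_piD, OMq_piZ) scalerDr.
Qed.

Lemma OMq_scaleDl (a : OMq) : {morph OMq_scale^~ a : c d / c + d}.
Proof.
by elim/OMq_ind: a => u c d; rewrite -!(OMq_piD, OMq_piZ) scalerDl.
Qed.

HB.instance Definition _ := GRing.Zmodule_isLmodule.Build K OMq
  OMq_scaleA OMq_scale1 OMq_scaleDr OMq_scaleDl.

Lemma OMq_scaleAl (c : K) (a b : OMq) : c *: (a * b) = (c *: a) * b.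
Proof.
elim/OMq_ind: a => u; elim/OMq_ind: b => v.
by rewrite -[LHS]/(OMq_scale _ (OMq_mul _ _)) -[RHS]/(OMq_mul (OMq_scale _ _) _)
           -!(OMq_piM, OMq_piZ) scalerAl.
Qed.

HB.instance Definition _ := GRing.Lmodule_isLalgebra.Build K OMq OMq_scaleAl.

Lemma OMq_scaleAr (c : K) (a b : OMq) : c *: (a * b) = a * (c *: b).
Proof.
elim/OMq_ind: a => u; elim/OMq_ind: b => v.
by rewrite -[LHS]/(OMq_scale _ (OMq_mul _ _)) -[RHS]/(OMq_mul _ (OMq_scale _ _))
           -!(OMq_piM, OMq_piZ) malg_scalerAr.
Qed.

HB.instance Definition _ := GRing.Lalgebra_isAlgebra.Build K OMq OMq_scaleAr.

Lemma OMq_pi_zmod_morphism : zmod_morphism OMq_pi.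
Proof. by move=> u v; apply/eqP; rewrite eq_sym subr_eq -OMq_piD subrK. Qed.

HB.instance Definition _ := GRing.isZmodMorphism.Build (freeAlg K n) OMq OMq_pi
  OMq_pi_zmod_morphism.

Lemma OMq_pi_monoid_morphism : monoid_morphism OMq_pi.
Proof. by split=> [|u v]; rewrite ?OMq_piM. Qed.

HB.instance Definition _ := GRing.isMonoidMorphism.Build (freeAlg K n) OMq OMq_pi
  OMq_pi_monoid_morphism.

HB.instance Definition _ := GRing.isScalable.Build K (freeAlg K n) OMq *:%R
  OMq_pi OMq_piZ.

Definition qX : 'M[OMq]_n := \matrix_(i, j) OMq_pi (fgen i j).

Lemma qX_rel i j k l :
  qX i j * qX k l - qX k l * qX i j
  = (q ^ theta j l - q ^ (- theta i k)) *: (qX i l * qX k j).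
Proof.
have piM u v : OMq_pi u * OMq_pi v = OMq_pi (u * v) by rewrite OMq_piM.
have piZ c u : c *: OMq_pi u = OMq_pi (c *: u) by rewrite OMq_piZ.
rewrite !mxE (piM (fgen i j)) (piM (fgen k l)) (piM (fgen i l)) piZ.
rewrite -OMq_pi_zmod_morphism.
by apply/OMq_eq/qidealP; exact: qideal_rel.
Qed.

End QuantumMatrixAlgebra.

Section QuantumPowersAndMinors.
Variables (K : fieldType) (q : K) (n : nat) (A : algType K).

(* the q-multiplication *)
Definition qmulmx (B C : 'M[A]_n) : 'M[A]_n :=
  \matrix_(i, j) \sum_(k < n) q ^ theta j k *: (B i k * C k j).

Variable X : 'M[A]_n.

Fixpoint qpow (k : nat) : 'M[A]_n :=
  match k with
  | 0 => 1%:M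
  | 1 => X
  | k'.+1 => qmulmx X (qpow k')
  end.

Definition qtrace (k : nat) : A := \tr (qpow k).

Definition inversions (k : nat) (s : 'S_k) : nat :=
  #|[set p : 'I_k * 'I_k | (p.1 < p.2)%N && (s p.2 < s p.1)%N]|.

(* The quantum minor [I|J].  On a subset of 'I_n, enum_val lists the elements
   in increasing order; \prod over 'I_k multiplies from left to right. *)
Definition qminor (I J : {set 'I_n}) (eqIJ : #|I| = #|J|) : A :=
  \sum_(s : 'S_#|I|) (- q) ^+ inversions s *:
    \prod_(a < #|I|) X (enum_val a) (enum_val (cast_ord eqIJ (s a))).

(* For k > n the sum is empty, so that qsigma k = 0. *)
Definition qsigma (k : nat) : A :=
  \sum_(I : {set 'I_n} | #|I| == k) qminor (erefl #|I|).

End QuantumPowersAndMinors.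

(* Main.v *)
(* Classically, sum_{l <= k} (-1)^l X^(k+1-l) sigma_l = (-1)^k H_k, where the
   (i, j) entry of H_k is the sum over the k-subsets I of the minors with rows
   {i} u I and columns {j} u I; the trace of H_k is (k+1) sigma_(k+1).  The same
   holds for quantum powers once each minor is computed with row i placed first
   and weighted by (-q)^-#{m in I | m < j}.  Expanding along that first row gives
   H_(k+1) = sigma_(k+1) X - X * H_k: the factors q^theta of the q-multiplication
   are exactly the powers of -q lost or gained when a row m, placed first, is
   moved to its sorted position.  Only the behaviour of a quantum minor under an
   exchange of adjacent rows uses the defining relations. *)

Require Import Defs.
From mathcomp Require Import all_boot all_order all_algebra all_fingroup.
From mathcomp Require Import complex reals.

Set Implicit Arguments.
Unset Strict Implicit.
Unset Printing Implicit Defensive.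

Import GRing.Theory.
Local Open Scope ring_scope.

(** * Subsets of the index range, with [below J c] as the position of [c] in [J] *)

Definition below n (J : {set 'I_n}) (c : 'I_n) : nat :=
  #|[set m in J | (m < c)%N]|.

Lemma belowD1 n (J : {set 'I_n}) (c d : 'I_n) :
  d \in J -> below J c = ((d < c) + below (J :\ d) c)%N.
Proof.
move=> dJ; rewrite /below (cardsD1 d) !inE dJ /=; congr (_ + _)%N.
by apply: eq_card => m; rewrite !inE andbA.
Qed.

Lemma belowU1 n (J : {set 'I_n}) (c d : 'I_n) :
  d \notin J -> below (d |: J) c = ((d < c) + below J c)%N.
Proof. by move=> dJ; rewrite (@belowD1 _ _ _ d) ?setU11 // setU1K. Qed.

Lemma sorted_enum_set n (J : {set 'I_n}) :
  sorted (relpre val ltn) (enum J : seq 'I_n).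
Proof.
rewrite {1}/enum_mem; apply: sorted_filter; first by move=> b a c; exact: ltn_trans.
by rewrite -enumT -sorted_map val_enum_ord iota_ltn_sorted.
Qed.

(** Both lists are strictly increasing with the same elements; the merge is what inserting a row
    produces in [rowdet_merge]. *)
Lemma enum_setU1 n (J : {set 'I_n}) (m : 'I_n) : m \notin J ->
  enum (m |: J) = merge (relpre val leq) [:: m] (enum J).
Proof.
move=> mJ; apply: (@irr_sorted_eq _ (relpre val ltn)).
- by move=> a b c; exact: ltn_trans.
- by move=> a; exact: ltnn.
- exact: sorted_enum_set.
- rewrite -sorted_map ltn_sorted_uniq_leq map_inj_uniq; last exact: val_inj.
  rewrite merge_uniq /= enum_uniq mem_enum mJ /= sorted_map.
  apply: merge_sorted => //.
  by apply: sub_sorted (sorted_enum_set J) => a b /=; exact: ltnW.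
- by move=> a; rewrite mem_merge mem_cat !mem_enum !inE.
Qed.

Lemma sum_setU1 n (V : nmodType) (m : 'I_n) (P : pred {set 'I_n})
    (G : {set 'I_n} -> V) :
  \sum_(K | P K && (m \in K)) G K
  = \sum_(L : {set 'I_n} | P (m |: L) && (m \notin L)) G (m |: L).
Proof.
rewrite (reindex_onto (setU [set m]) (fun K => K :\ m)); last first.
  by move=> K /andP[_ mK]; rewrite setD1K.
apply: eq_bigl => L; rewrite setU11 andbT; congr (_ && _).
apply/eqP/idP => [<-|/setU1K //]; by rewrite !inE eqxx.
Qed.

Lemma sum_pairs n (V : nmodType) (J : {set 'I_n}) (F : 'I_n -> 'I_n -> V) :
  \sum_(c in J) \sum_(d in J :\ c) F c d
  = \sum_(c in J) \sum_(d in J | (c < d)%N) (F c d + F d c).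
Proof.
have split c : \sum_(d in J :\ c) F c d
    = \sum_(d in J | (c < d)%N) F c d + \sum_(d in J | (d < c)%N) F c d.
  rewrite (bigID (fun d : 'I_n => (c < d)%N)) /=.
  by congr (_ + _); apply: eq_bigl => d; rewrite !inE -val_eqE /=; case: ltngtP;
    rewrite ?andbF ?andbT.
rewrite (eq_bigr _ (fun c _ => split c)) big_split /=.
rewrite [X in _ + X](exchange_big_dep (mem J)) /=; last by move=> ? ? _ /andP[].
rewrite -big_split /=; apply: eq_bigr => c cJ; rewrite big_split /=.
congr (_ + _); apply: eq_bigl => d; rewrite cJ //.
Qed.

(** * First-row expansion and exchange of rows *)

Section RowDet.
Variables (K : fieldType) (q : K) (n : nat) (A : algType K) (X : 'M[A]_n).

(* Quantum determinant with rows r (in the given order, repetitions allowed)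
   and column set J, by expansion along the first row. *)
Fixpoint rowdet (r : seq 'I_n) (J : {set 'I_n}) : A :=
  match r with
  | [::] => (J == set0)%:R
  | i :: r' => \sum_(c in J) (- q) ^+ below J c *: (X i c * rowdet r' (J :\ c))
  end.

Arguments rowdet : simpl never.

Lemma rowdet_nil : rowdet [::] set0 = 1.
Proof. by rewrite /rowdet eqxx. Qed.

Lemma rowdet_cons i r (J : {set 'I_n}) : rowdet (i :: r) J =
  \sum_(c in J) (- q) ^+ below J c *: (X i c * rowdet r (J :\ c)).
Proof. by []. Qed.

Hypothesis Xrel : forall i j k l,
  X i j * X k l - X k l * X i j
  = (q ^ theta j l - q ^ (- theta i k)) *: (X i l * X k j).
Hypothesis q0 : q != 0.

(** Grouping by column pairs [c < d] leaves 2 x 2 quantum minors: choosing [d] first costs one more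
    factor [- q], since [c] still lies below [d]. *)
Lemma rowdet2 i i' r (J : {set 'I_n}) : rowdet (i :: i' :: r) J =
  \sum_(c in J) \sum_(d in J | (c < d)%N)
    (- q) ^+ (below J c + below (J :\ c) d) *:
      ((X i c * X i' d - q *: (X i d * X i' c)) * rowdet r (J :\ c :\ d)).
Proof.
pose F c d := (- q) ^+ (below J c + below (J :\ c) d) *:
   (X i c * X i' d * rowdet r (J :\ c :\ d)).
transitivity (\sum_(c in J) \sum_(d in J :\ c) F c d).
  rewrite rowdet_cons; apply: eq_bigr => c _; rewrite rowdet_cons mulr_sumr scaler_sumr.
  by apply: eq_bigr => d _; rewrite -scalerAr scalerA -exprD mulrA.
rewrite sum_pairs; apply: eq_bigr => c cJ; apply: eq_bigr => d /andP[dJ cd].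
rewrite /F (belowD1 d cJ) cd (belowD1 c dJ) ltnNge ltnW //= add0n.
have -> : J :\ d :\ c = J :\ c :\ d by rewrite !setDDl setUC.
have bE : below (J :\ d) c = below (J :\ c) c.
  by apply: eq_card => m; rewrite !inE; case: (ltnP m c) => mc;
    rewrite ?andbF // !andbT -!val_eqE /= !neq_ltn mc (ltn_trans mc cd).
rewrite bE mulrBl scalerBr; congr (_ + _).
by rewrite add1n addSn exprSr addnC -scalerA scaleNr scalerN -scalerAl.
Qed.

Lemma rowdet_dup i r J : rowdet (i :: i :: r) J = 0.
Proof.
rewrite rowdet2 big1 // => c cJ; rewrite big1 // => d /andP[dJ cd].
(* Within one row the relation reads [X i c * X i d = q *: (X i d * X i c)], so each 2 x 2 minor
   vanishes. *)
have := Xrel i c i d; rewrite /theta cd ltnn eqxx oppr0 expr0z expr1z.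
rewrite scalerBl scale1r => /(can_inj (addrK _)) ->.
by rewrite subrr mul0r scaler0.
Qed.

Lemma rowdet_swap (i i' : 'I_n) r J : (i' < i)%N ->
  rowdet (i :: i' :: r) J = - q *: rowdet (i' :: i :: r) J.
Proof.
move=> ii'; rewrite !rowdet2 scaler_sumr; apply: eq_bigr => c cJ.
rewrite scaler_sumr; apply: eq_bigr => d /andP[dJ cd].
rewrite scalerA mulrC -scalerA; congr (_ *: _); rewrite [RHS]scalerAl; congr (_ * _).
(* The first relation makes [X i' d] and [X i c] commute; the second exchanges [X i' c] and [X i d]
   up to a multiple [q - q ^ (-1)] of [X i' d * X i c]. *)
have:= Xrel i' d i c; have:= Xrel i' c i d.
rewrite /theta cd ii' ltnNge ltnW //= eqn_leq leqNgt cd /= expr1z.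
rewrite subrr scale0r => /(canRL (subrK _)) uE /subr0_eq <-.
have {uE} -> : X i d * X i' c = X i' c * X i d - (q - q ^ (-1)) *: (X i' d * X i c).
  by rewrite uE addrC addrA addNr add0r.
rewrite scalerBr scalerA mulrBr mulfV // scalerBl scale1r.
rewrite scalerBr scalerA mulNr !scaleNr opprK opprB.
by rewrite addrA subrKC addrC.
Qed.

(** Insertion sort: [m] passes each smaller row at the price of a factor [- q], and gives zero when
    it meets an equal row. *)
Lemma rowdet_merge (m : 'I_n) (s : seq 'I_n) J :
    sorted (relpre val ltn) s ->
  rowdet (m :: s) J =
    if m \in s then 0 else
    (- q) ^+ count (fun a : 'I_n => (a < m)%N) s
      *: rowdet (merge (relpre val leq) [:: m] s) J.
Proof.
elim: s J => [|a s IHs] J; first by rewrite /= expr0 scale1r.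
move=> /= s_path; have s_sorted := path_sorted s_path.
have lt_a b : b \in s -> (a < b)%N.
  have tr : transitive (relpre (val : 'I_n -> nat) ltn).
    by move=> y x z; exact: ltn_trans.
  by move/(order_path_min tr)/allP: s_path; apply.
rewrite inE; case: (ltngtP m a) => [ma|am|/val_inj <-].
- rewrite -val_eqE (ltn_eqF ma) /= add0n ifN; last first.
    by apply/negP => /lt_a /(ltn_trans ma); rewrite ltnn.
  rewrite (_ : count _ s = 0%N) ?expr0 ?scale1r //.
  apply/eqP; rewrite -leqn0 leqNgt -has_count; apply/hasPn => b /lt_a ab.
  by rewrite -leqNgt ltnW // (ltn_trans ma).
- rewrite -val_eqE (gtn_eqF am) /= (rowdet_swap _ _ am).
  (* Now [a] is the first row, and [m :: s] occurs inside its expansion with columns [J :\ c]. *)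
  have step J' := IHs J' s_sorted.
  rewrite !rowdet_cons.
  under eq_bigr => c _ do rewrite (step (J :\ c)).
  case: ifP => _; first by rewrite big1 ?scaler0 // => c _; rewrite mulr0 scaler0.
  rewrite add1n exprS -scalerA; congr (_ *: _).
  rewrite scaler_sumr; apply: eq_bigr => c _.
  by rewrite -scalerAr !scalerA mulrC.
- by rewrite eqxx /= rowdet_dup.
Qed.

Lemma count_below (L : {set 'I_n}) (m : 'I_n) :
  count (fun a : 'I_n => (a < m)%N) (enum L) = below L m.
Proof.
rewrite -size_filter /below cardE; congr size.
rewrite {1}/enum_mem -filter_predI; apply: eq_filter => a.
by rewrite /= !inE andbC.
Qed.

Lemma rowdet_cons_enum (m : 'I_n) (L J : {set 'I_n}) :
  rowdet (m :: enum L) J =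
    if m \in L then 0 else (- q) ^+ below L m *: rowdet (enum (m |: L)) J.
Proof.
rewrite (rowdet_merge _ _ (sorted_enum_set L)) mem_enum count_below.
by case: ifPn => // mL; rewrite enum_setU1.
Qed.

End RowDet.

Arguments rowdet : simpl never.

(** * Agreement of [rowdet] with the sums over permutations *)

Lemma card_ord_below k (j : nat) : (j <= k)%N -> (\sum_(b < k) (b < j) = j)%N.
Proof.
move=> jk; rewrite -big_mkcond (big_ord_narrow jk) sum1_card card_ord //.
Qed.

Lemma ltn_lift2 k (j : 'I_k.+1) (a b : 'I_k) : (lift j a < lift j b)%N = (a < b)%N.
Proof. by rewrite !ltnNge leq_bump2. Qed.

Lemma map_enum_val (T : finType) (B : {pred T}) :
  [seq enum_val i | i <- enum 'I_#|B|] = enum B.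
Proof.
case: (pickP B) => [x0 _|B0].
  rewrite (eq_map (enum_val_nth x0)) (map_comp (nth x0 (enum B))).
  by rewrite val_enum_ord cardE -/(mkseq _ _) mkseq_nth.
have eB : enum B = [::] by apply/eqP; rewrite -size_eq0 -cardE eq_card0.
by rewrite eB; apply: size0nil; rewrite size_map size_enum_ord eq_card0.
Qed.

Section Permutations.
Variables (K : fieldType) (q : K) (n : nat) (A : algType K) (X : 'M[A]_n).

Lemma inversionsE k (s : 'S_k) :
  inversions s = (\sum_(a < k) \sum_(b < k) ((a < b) && (s b < s a)))%N.
Proof.
rewrite pair_big /= -big_mkcond sum1_card /inversions.
by apply: eq_card => p; rewrite !inE.
Qed.

(** The first place takes the value [j], and exactly [j] smaller values come after it; the other
    inversions are those of [s]. *)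
Lemma inversions_lift k (j : 'I_k.+1) (s : 'S_k) :
  inversions (lift_perm ord0 j s) = (j + inversions s)%N.
Proof.
rewrite !inversionsE big_ord_recl; congr (_ + _)%N.
  rewrite big_ord_recl ltnn add0n.
  under eq_bigr => b _ do rewrite lift_perm_id lift_perm_lift.
  rewrite (reindex_inj (@perm_inj _ s^-1%g)) /=.
  under eq_bigr => b _ do rewrite permKV.
  rewrite -[RHS](card_ord_below (ltn_ord j : (j <= k)%N)).
  apply: eq_bigr => b _; rewrite /bump; case: (leqP j b) => jb /=.
    by rewrite add1n ltnNge ltnW.
  by rewrite add0n jb.
apply: eq_bigr => a _; rewrite big_ord_recl ltn0 add0n.
apply: eq_bigr => b _; rewrite !lift_perm_lift !ltn_lift2 //.
Qed.

(** Index functions, unlike subsets, restrict along [lift], which suits induction on [k]. *)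
Definition permsum k (f g : 'I_k -> 'I_n) : A :=
  \sum_(s : 'S_k) (- q) ^+ inversions s *: \prod_(a < k) X (f a) (g (s a)).

Lemma permsum0 (f g : 'I_0 -> 'I_n) : permsum f g = 1.
Proof.
rewrite /permsum (big_pred1 1%g); last first.
  by move=> s; apply/esym/eqP/permP; case.
rewrite big_ord0 /inversions eq_card0 ?expr0 ?scale1r // => -[[]] //.
Qed.

Lemma permsumS k (f g : 'I_k.+1 -> 'I_n) :
  permsum f g = \sum_(j < k.+1) (- q) ^+ j *:
    (X (f ord0) (g j) * permsum (f \o lift ord0) (g \o lift j)).
Proof.
rewrite /permsum (partition_big (fun s : 'S_k.+1 => s ord0) predT) //=.
apply: eq_bigr => j _; rewrite mulr_sumr scaler_sumr.
rewrite (reindex (lift_perm ord0 j)); last first.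
  (* For the inverse of [lift_perm ord0 j]: delete [i] and its image [s i]. The default [l] is never
     reached, as [s] is injective. *)
  pose ulsf i (s : 'S_k.+1) l := odflt l (unlift (s i) (s (lift i l))).
  have ulsfK i (s : 'S_k.+1) l: lift (s i) (ulsf i s l) = s (lift i l).
    rewrite /ulsf; have:= neq_lift i l.
    by rewrite -(can_eq (permK s)) => /unlift_some[] ? ? ->.
  have inj_ulsf: injective (ulsf ord0 _).
    move=> s; apply: can_inj (ulsf (s ord0) s^-1%g) _ => l'.
    by rewrite {1}/ulsf ulsfK !permK liftK.
  exists (fun s => perm (inj_ulsf s)) => [s _ | s].
    by apply/permP=> l; rewrite permE /ulsf lift_perm_lift lift_perm_id liftK.
  move/(s _ =P _) => si0; apply/permP=> l.
  case: (unliftP ord0 l) => [l'|] ->; rewrite ?lift_perm_id //.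
  by rewrite lift_perm_lift -si0 permE ulsfK.
apply: eq_big => [s | s _]; first by rewrite lift_perm_id eqxx.
rewrite inversions_lift exprD -scalerA -scalerAr big_ord_recl lift_perm_id.
congr (_ *: (_ *: (_ * _))); apply: eq_bigr => a _.
by rewrite lift_perm_lift.
Qed.

(** Both sides have the same first-row expansion: as [g] is increasing, exactly [j] columns lie
    below [g j]. *)
Lemma rowdet_permsum k (f g : 'I_k -> 'I_n) :
    {homo g : a b / (a < b)%N} ->
  rowdet q X (map f (enum 'I_k)) [set g a | a : 'I_k] = permsum f g.
Proof.
elim: k f g => [|k IHk] f g g_mono.
  rewrite permsum0 (eqP (_ : enum 'I_0 == [::])) /=; last first.
    by rewrite -size_eq0 size_enum_ord.
  rewrite (_ : [set g a | a : 'I_0] = set0) ?rowdet_nil //.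
  by apply/setP => c; rewrite inE; apply/imsetP => -[[]].
have g_inj : injective g.
  by move=> a b gab; case: (ltngtP a b) => [/g_mono|/g_mono|/val_inj //];
    rewrite gab ltnn.
have lt_g a b : (g a < g b)%N = (a < b)%N.
  case: (ltngtP a b) => [/g_mono //|/g_mono ba|/val_inj ->]; last exact: ltnn.
  by rewrite ltnNge ltnW.
rewrite enum_ordSl /= permsumS rowdet_cons big_imset /=; last by move=> ? ? _ _; exact: g_inj.
apply: eq_bigr => j _; congr (_ ^+ _ *: (_ * _)).
  rewrite -[RHS](card_ord_below (ltnW (ltn_ord j))) -big_mkcond sum1_card.
  rewrite -(card_imset _ g_inj); apply: eq_card => c; rewrite inE.
  apply/andP/imsetP => [[/imsetP[a _ ->]]|[a aj ->]].
    by rewrite lt_g => aj; exists a.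
  by rewrite imset_f ?lt_g.
rewrite -map_comp -IHk; last by move=> a b ab; apply: g_mono; rewrite ltn_lift2.
congr rowdet; apply/setP => c; rewrite !inE.
apply/andP/imsetP => [[cj /imsetP[a _ ca]]|[a _ ->]].
  move: cj; rewrite {}ca; case: (unliftP j a) => [a' ->|->]; last by rewrite eqxx.
  by exists a'.
by rewrite (inj_eq g_inj) eq_sym neq_lift; split=> //; apply: imset_f.
Qed.

Lemma qminor_rowdet (I : {set 'I_n}) :
  qminor q X (erefl #|I|) = rowdet q X (enum I) I.
Proof.
have eI' : [set enum_val a | a : 'I_#|I|] = I.
  apply/setP => c; apply/imsetP/idP => [[a _ ->]|cI]; first exact: enum_valP.
  by exists (enum_rank_in cI c); rewrite ?enum_rankK_in.
rewrite -[in RHS]map_enum_val -[X in rowdet _ _ _ X]eI' rowdet_permsum.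
  rewrite /qminor /permsum; apply: eq_bigr => s _; congr (_ *: _).
  by apply: eq_bigr => a _; rewrite cast_ord_id.
move=> a b ab; have x0 : 'I_n := enum_val a; rewrite !(enum_val_nth x0).
apply: (sorted_ltn_nth _ _ (sorted_enum_set I)); rewrite ?inE -?cardE //.
by move=> ? ? ?; exact: ltn_trans.
Qed.

End Permutations.

(** * The matrices [H_k] and the Newton identities *)

Section Newton.
Variables (K : fieldType) (q : K) (n : nat) (A : algType K) (X : 'M[A]_n).

Hypothesis Xrel : forall i j k l,
  X i j * X k l - X k l * X i j
  = (q ^ theta j l - q ^ (- theta i k)) *: (X i l * X k j).
Hypothesis q0 : q != 0.

Let minor (I : {set 'I_n}) : A := rowdet q X (enum I) I.

Lemma qsigmaE k : qsigma q X k = \sum_(I : {set 'I_n} | #|I| == k) minor I.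
Proof. by apply: eq_bigr => I _; rewrite qminor_rowdet. Qed.

(* The (i, j) entry of the matrix H_k. *)
Definition hook k (i j : 'I_n) : A :=
  \sum_(I : {set 'I_n} | (#|I| == k) && (j \notin I))
    (- q) ^- below I j *: rowdet q X (i :: enum I) (j |: I).

Let Nq0 m : (- q) ^+ m != 0.
Proof. by rewrite expf_neq0 // oppr_eq0. Qed.

(** Sorting row [j] into [I] costs [(- q) ^+ below I j], which cancels the weight in [hook]. *)
Lemma hook_diag k j :
  hook k j j = \sum_(I : {set 'I_n} | (#|I| == k.+1) && (j \in I)) minor I.
Proof.
rewrite sum_setU1; apply: eq_big => [I|I /andP[_ jI]].
  by have [|jI] := boolP (j \in I); rewrite ?andbF // cardsU1 jI.
rewrite (rowdet_cons_enum Xrel q0) (negPf jI) scalerA mulVf // scale1r.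
by [].
Qed.

(** Each set of size [k.+1] is counted once for each of its elements. *)
Lemma hook_trace k : \sum_j hook k j j = qsigma q X k.+1 *+ k.+1.
Proof.
under eq_bigr => j _ do rewrite hook_diag.
rewrite (exchange_big_dep (fun I : {set 'I_n} => #|I| == k.+1)) /=; last first.
  by move=> j I _ /andP[].
rewrite qsigmaE -sumrMnl; apply: eq_bigr => I /eqP cardI.
by rewrite -{2}cardI -sumr_const; apply: eq_bigl => j; rewrite cardI eqxx.
Qed.

Lemma hook0 i j : hook 0 i j = X i j.
Proof.
rewrite /hook (big_pred1 set0) => [|I]; last first.
  by rewrite cards_eq0 /=; have [->|] := eqVneq I set0; rewrite ?inE.
have b0 J : below set0 J = 0%N by apply: eq_card0 => m; rewrite !inE.
rewrite b0 expr0 invr1 scale1r enum_set0 setU0 rowdet_cons big_set1.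
rewrite setDv rowdet_nil mulr1 -[[set j]]setU0 belowU1 ?inE // ltnn b0.
by rewrite expr0 scale1r.
Qed.

(** Exactly one of [c < j] and [j < c] holds, contributing the inverse of [- q] or [- q] itself;
    either is [- q ^ theta j c]. *)
Lemma hook_coef (j c : 'I_n) (L : {set 'I_n}) :
    c != j -> j \notin L -> c \notin L ->
  (- q) ^- below (c |: L) j * (- q) ^+ below (j |: (c |: L)) c
  = - (q ^ theta j c * (- q) ^- below L j * (- q) ^+ below L c).
Proof.
move=> cj jL cL.
have jcL : j \notin c |: L by rewrite !inE negb_or eq_sym cj.
rewrite !belowU1 // ltnn add0n !exprD invfM.
suff: ((- q) ^+ (c < j)%N)^-1 * (- q) ^+ (j < c)%N = - q ^ theta j c.
  by rewrite mulrACA => ->; rewrite !mulNr mulrA.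
rewrite /theta; case: (ltngtP j c) => [_|_|jc].
- by rewrite expr0 invr1 mul1r.
- by rewrite expr0 mulr1 expr1 invrN.
- by rewrite (val_inj jc) eqxx in cj.
Qed.

Lemma hookS k i j :
  hook k.+1 i j = X i j * qsigma q X k.+1
    - \sum_(m < n) q ^ theta j m *: (X i m * hook k m j).
Proof.
have step (I : {set 'I_n}) : j \notin I ->
    (- q) ^- below I j *: rowdet q X (i :: enum I) (j |: I) =
    X i j * minor I + \sum_(c in I)
      ((- q) ^- below I j * (- q) ^+ below (j |: I) c) *:
         (X i c * rowdet q X (enum I) ((j |: I) :\ c)).
  move=> jI; rewrite rowdet_cons big_setU1 //= scalerDr scaler_sumr.
  rewrite belowU1 // ltnn add0n scalerA mulVf // scale1r setU1K //.
  by congr (_ + _); apply: eq_bigr => c _; rewrite scalerA.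
rewrite /hook (eq_bigr _ (fun I h => step I (andP h).2)) {step} big_split /=.
(* The term [m = j] collects the principal minors of sets containing [j]; it cancels them in
   [qsigma], leaving the sets that avoid [j]. *)
rewrite -mulr_sumr [in RHS](bigD1 j) //= {1}/theta ltnn eqxx expr0z scale1r.
rewrite -/(hook k j j) hook_diag opprD addrA -mulrBr qsigmaE.
rewrite [\sum_(I : {set 'I_n} | #|I| == k.+1) _](bigID (fun I : {set 'I_n} => j \in I)) /=.
rewrite [(_ + _) - _]addrAC subrr add0r; congr (_ + _).
rewrite (exchange_big_dep (fun c => c != j)) /=; last first.
  by move=> I c /andP[_ jI] cI; apply: contraNneq jI => <-.
(* For a column [c] in [I], write [I] as [c |: L], to be compared with the rows [c :: enum L] of
   [hook k c j]. *)
rewrite -sumrN; apply: eq_bigr => c cj; rewrite sum_setU1.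
rewrite mulr_sumr scaler_sumr -sumrN.
(* Sets [L] containing [c] contribute zero to [hook k c j], because row [c] is repeated. *)
rewrite [RHS](bigID (fun L : {set 'I_n} => c \in L)) /=.
rewrite [X in _ = X + _]big1 ?add0r; last first.
  move=> L /andP[_ cL]; rewrite (rowdet_cons_enum Xrel q0) cL.
  by rewrite scaler0 mulr0 scaler0 oppr0.
apply: eq_big => [L|L /andP[/andP[_]]].
  have [|cL] := boolP (c \in L); rewrite ?andbF //= !andbT cardsU1 cL.
  by rewrite !inE negb_or [j == c]eq_sym cj.
rewrite !inE negb_or => /andP[_ jL] cL.
rewrite hook_coef // (rowdet_cons_enum Xrel q0) (negPf cL) scaleNr.
have -> : (j |: (c |: L)) :\ c = j |: L.
  by rewrite setUCA setU1K // !inE negb_or cj.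
by rewrite -!scalerAr !scalerA !mulrA.
Qed.

Lemma qsigma0 : qsigma q X 0 = 1.
Proof.
rewrite qsigmaE (big_pred1 set0) => [|I]; last by rewrite cards_eq0.
by rewrite /minor enum_set0 rowdet_nil.
Qed.

Lemma qpowS m i j : (0 < m)%N ->
  qpow q X m.+1 i j = \sum_(c < n) q ^ theta j c *: (X i c * qpow q X m c j).
Proof. by case: m => // m _; rewrite /= mxE. Qed.

(** Induction unrolling [hookS]: a factor [X] splits off on the left while [qsigma] stays on the
    right, so the q-multiplication need not be associative. *)
Lemma qpow_hook k i j :
  \sum_(l < k.+1) (-1) ^+ l * (qpow q X (k.+1 - l) i j * qsigma q X l)
  = (-1) ^+ k * hook k i j.
Proof.
elim: k i j => [|k IHk] i j.
  by rewrite big_ord1 !expr0 !mul1r qsigma0 mulr1 hook0.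
rewrite big_ord_recr /= subSnn hookS mulrBr addrC; congr (_ + _).
rewrite exprS mulN1r mulNr opprK.
under eq_bigr => l _.
  rewrite (subSn (ltnW (ltn_ord l))) qpowS ?subn_gt0 // mulr_suml mulr_sumr. over.
rewrite exchange_big mulr_sumr; apply: eq_bigr => m _ /=.
have signCA l (x y : A) : (-1) ^+ l * (x * y) = x * ((-1) ^+ l * y).
  by rewrite !mulrA (commr_sign x l).
rewrite -scalerAr signCA -IHk mulr_sumr scaler_sumr; apply: eq_bigr => l _.
by rewrite -scalerAl -scalerAr -mulrA [in LHS]signCA.
Qed.

Lemma newton k :
  \sum_(l < k.+1) (-1) ^+ l * (qtrace q X (k.+1 - l) * qsigma q X l)
  = (-1) ^+ k * (qsigma q X k.+1 *+ k.+1).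
Proof.
rewrite -hook_trace mulr_sumr; under [RHS]eq_bigr => j _ do rewrite -qpow_hook.
rewrite exchange_big /=; apply: eq_bigr => l _.
by rewrite /qtrace /mxtrace mulr_suml mulr_sumr.
Qed.

End Newton.

Theorem lemma3 (R : realType) (n : nat) (hn : (1 <= n)%N)
    (q : R[i]) (hq : q != 0) (k : nat) (hk : (1 <= k)%N) :
  let X := qX q n in
  let t := qtrace q X in
  let sigma := qsigma q X in
  t k + \sum_(1 <= j < k) (-1) ^+ j * (t (k - j)%N * sigma j)
      + (-1) ^+ k * (sigma k *+ k) = 0 :> OMq q n.
Proof.
case: k hk => // k _ X t sigma.
(* The term [l = 0] is [t k.+1], because [sigma 0 = 1]. *)
have := newton (@qX_rel _ q n) hq k; rewrite big_ord_recl expr0 mul1r subn0.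
rewrite -/X -/t -/sigma [sigma 0]qsigma0 mulr1 big_add1 big_mkord => ->.
by rewrite exprS mulN1r mulNr subrr.
Qed.
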